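(* Let $p\in[1,\infty)$ and let $\varphi:\mathbb{R}\to\mathbb{R}$ be a function. Then: (1) $\varphi$ preserves $L_p$-convergence if and only if $\varphi$ is Lipschitz continuous; (2) $\varphi$ preserves convergence almost in $L_p$ if and only if $\varphi$ is Lipschitz continuous; (3) $\varphi$ preserves $\alpha_p$-convergence if and only if $\varphi$ is Lipschitz continuous.
   Context: Given a measure space $(X,\mathbb{X},\mu)$, measurable functions are $\mathbb{X}$-measurable real-valued functions on $X$ (not assumed to belong to $L_p$), and for $B\in\mathbb{X}$, $B^c$ denotes the complement of $B$ in $X$. Let $(f_n)$ be a sequence of measurable functions and $f$ a measurable function. - $(f_n)$ converges to $f$ in $L_p$ ($L_p$-convergence) if $\int_X|f_n-f|^p\,d\mu\to 0$ as $n\to\infty$. - $(f_n)$ converges to $f$ almost in $L_p$ if for each $\delta>0$ there exists a measurable set $E_\delta$ with $\mu(E_\delta)<\delta$ such that $\int_{E_\delta^c}|f_n-f|^p\,d\mu\to 0$ as $n\to\infty$. - $(f_n)$ $\alpha_p$-converges to $f$ if there exists a sequence of measurable sets $(B_n)$ with $\mu(B_n^c)\to 0$ as $n\to\infty$ such that $\int_{B_n}|f_n-f|^p\,d\mu\to 0$ as $n\to\infty$. Let $\mathfrak{m}$ be a notion of convergence for sequences of measurable functions. A function $\varphi:\mathbb{R}\to\mathbb{R}$ is said to preserve $\mathfrak{m}$-convergence if, given any measure space $(X,\mathbb{X},\mu)$ and any sequence $(f_n)$ of $\mathbb{X}$-measurable functions that $\mathfrak{m}$-converges to a measurable function $f$,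 the sequence $(\varphi(f_n))$ $\mathfrak{m}$-converges to $\varphi(f)$, where $\varphi(g)$ denotes the composition $\varphi\circ g$. (The measure space is not fixed: it ranges over all measure spaces.) *)

(* Defs.v *)
From HB Require Import structures.
From mathcomp Require Import all_boot all_order all_algebra.
From mathcomp Require Import all_classical all_reals all_analysis.

Set Implicit Arguments.
Unset Strict Implicit.
Unset Printing Implicit Defensive.
Import Order.TTheory GRing.Theory Num.Theory.
Import numFieldNormedType.Exports.

Local Open Scope classical_set_scope.
Local Open Scope ring_scope.
Local Open Scope ereal_scope.

(* The functions compared by these three modes are meant to be measurable;
   [preserves_convergence] below imposes it. Integrals and measures take values
   in [\bar R], and finitely many of them may be infinite in a sequence tending
   to 0: the functions need not be p-integrable. *)

Definition cvg_Lp (R : realType) (p : R) d (T : measurableType d)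
    (mu : {measure set T -> \bar R}) (f_ : nat -> T -> R) (f : T -> R) : Prop :=
  \int[mu]_x ((`|f_ n x - f x| `^ p)%R)%:E @[n --> \oo] --> 0.

Definition cvg_almost_Lp (R : realType) (p : R) d (T : measurableType d)
    (mu : {measure set T -> \bar R}) (f_ : nat -> T -> R) (f : T -> R) : Prop :=
  forall delta : R, (0 < delta)%R -> exists E : set T,
    [/\ measurable E, mu E < delta%:E &
        \int[mu]_(x in ~` E) ((`|f_ n x - f x| `^ p)%R)%:E @[n --> \oo] --> 0].

Definition cvg_alpha_p (R : realType) (p : R) d (T : measurableType d)
    (mu : {measure set T -> \bar R}) (f_ : nat -> T -> R) (f : T -> R) : Prop :=
  exists B : nat -> set T,
    [/\ forall n, measurable (B n), mu (~` B n) @[n --> \oo] --> 0 &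
        \int[mu]_(x in B n) ((`|f_ n x - f x| `^ p)%R)%:E @[n --> \oo] --> 0].

Definition convergence_mode (R : realType) : Type :=
  forall (d : measure_display) (T : measurableType d),
    {measure set T -> \bar R} -> (nat -> T -> R) -> (T -> R) -> Prop.

(* Convergence is a relation between measurable functions, so "phi \o f_ n
   converges to phi \o f" includes that these compositions are measurable;
   phi itself is arbitrary. A [measurableType] is pointed, hence nonempty;
   on the empty space every function would trivially preserve convergence. *)
Definition preserves_convergence (R : realType) (m : convergence_mode R)
    (phi : R -> R) : Prop :=
  forall (d : measure_display) (T : measurableType d)
    (mu : {measure set T -> \bar R}) (f_ : nat -> T -> R) (f : T -> R),
  (forall n, measurable_fun setT (f_ n)) -> measurable_fun setT f ->
  m d T mu f_ f ->
  [/\ forall n, measurable_fun setT (phi \o f_ n),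
      measurable_fun setT (phi \o f) &
      m d T mu (fun n => phi \o f_ n) (phi \o f)].

(* Main.v *)
Require Import Defs.
From mathcomp Require Import all_boot all_order all_algebra.
From mathcomp Require Import all_classical all_reals all_analysis.
From mathcomp Require Import measurable_realfun ring.
Set Implicit Arguments.
Unset Strict Implicit.
Unset Printing Implicit Defensive.
Import Order.TTheory GRing.Theory Num.Theory.
Import numFieldNormedType.Exports.
Local Open Scope classical_set_scope.
Local Open Scope ring_scope.

(** Sufficiency is pointwise: if phi is M-Lipschitz, then
    |phi(f_n) - phi(f)|^p <= M^p |f_n - f|^p, so over any measurable set the
    integral for the images is at most M^p times the original one. The
    exceptional sets that witness the convergence of f_n thus also witness that
    of phi(f_n), in each of the three modes ([cvg_integral_lipschitz]).

    For necessity one counterexample serves the three modes. If phi is not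
    Lipschitz, then for every n some pair x_n, y_n satisfies
    |phi x_n - phi y_n| >= (n+1) |x_n - y_n|. The pair can moreover be chosen
    close together, with (n+1) |x_n - y_n| <= 1: otherwise phi would satisfy
    the Lipschitz inequality at small scale, and subdividing segments would
    spread it to all scales ([local_bound_global]). Put on the natural numbers
    the measure with mass w_n = ((n+1) |x_n - y_n|)^-p at n, let f be y_k at
    each k, and let f_n differ from f only at n, where it is x_n. Then
    the integral of |f_n - f|^p is (n+1)^-p, which tends to 0, while that of
    |phi(f_n) - phi(f)|^p is at least 1. So phi does not preserve
    L_p-convergence.

    Closeness of the pairs gives w_n >= 1, so every nonempty set has measure
    at least 1. On such a space exceptional sets of small measure are empty, and
    convergence almost in L_p and alpha_p-convergence reduce to
    L_p-convergence. Since L_p-convergence always implies the other two, the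
    same sequence refutes the preservation of all three
    ([preserves_lipschitz]). *)

(** * Lipschitz functions and integrals *)

Lemma lipschitz_bound (R : realType) (phi : R -> R) :
  lipschitz phi ->
  exists2 M : R, 0 <= M & forall x y, `|phi x - phi y| <= M * `|x - y|.
Proof.
move=> /pinfty_ex_gt0[M M0 phiM]; exists M; first exact: ltW.
by move=> x y; apply: (phiM (x, y)).
Qed.

Lemma bound_lipschitz (R : realType) (phi : R -> R) (M : R) :
  (forall x y, `|phi x - phi y| <= M * `|x - y|) -> lipschitz phi.
Proof.
move=> phiM; apply: (@klipschitzW _ _ _ M) => [|[x y] _]; last exact: phiM.
exact: (@globally_properfilter _ _ (0, 0)).
Qed.

Lemma lipschitz_measurable (R : realType) (phi : R -> R) (M : R) :
  0 <= M -> (forall x y, `|phi x - phi y| <= M * `|x - y|) ->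
  measurable_fun setT phi.
Proof.
move=> M0 phiM; apply: continuous_measurable_fun => x.
apply/cvgrPdist_lt => e e0.
have M1 : 0 < M + 1 by rewrite ltr_wpDl.
near=> y; rewrite (le_lt_trans (phiM x y))//.
apply: (@le_lt_trans _ _ ((M + 1) * `|x - y|)).
  by rewrite ler_wpM2r// lerDl.
rewrite mulrC -ltr_pdivlMr//.
by near: y; apply: cvgr_dist_lt; rewrite ?divr_gt0.
Unshelve. all: by end_near. Qed.

Lemma integral_lipschitz_le (R : realType) (p M : R) d (T : measurableType d)
    (mu : {measure set T -> \bar R}) (D : set T) (phi : R -> R) (f g : T -> R) :
  0 <= p -> 0 <= M -> (forall x y, `|phi x - phi y| <= M * `|x - y|) ->
  measurable D -> measurable_fun setT f -> measurable_fun setT g ->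
  (\int[mu]_(x in D) (`|phi (f x) - phi (g x)| `^ p)%:E <=
   (M `^ p)%:E * \int[mu]_(x in D) (`|f x - g x| `^ p)%:E)%E.
Proof.
move=> p0 M0 phiM mD mf mg.
have mphi := lipschitz_measurable M0 phiM.
have mpow (u v : T -> R) : measurable_fun setT u -> measurable_fun setT v ->
    measurable_fun D (fun x => (`|u x - v x| `^ p)%:E).
  move=> mU mV; apply: (measurable_funS measurableT) => //.
  apply/measurable_EFinP.
  apply: (measurableT_comp (measurable_powR p)).
  by apply: measurableT_comp => //; exact: measurable_funB.
rewrite -ge0_integralZl//; last 2 first.
- exact: mpow.
- by rewrite lee_fin powR_ge0.
apply: ge0_le_integral => //.
- by apply: (mpow (phi \o f) (phi \o g)); exact: measurableT_comp.
- by apply: measurable_funeM; exact: mpow.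
- move=> x _; rewrite -EFinM lee_fin -powRM//.
  by apply: ge0_ler_powR => //; rewrite nnegrE ?mulr_ge0.
Qed.

(** The domain varies with n so that one statement covers the three modes: it
    is constant for the first two, and the set B_n for alpha_p-convergence. *)
Lemma cvg_integral_lipschitz (R : realType) (p M : R) d (T : measurableType d)
    (mu : {measure set T -> \bar R}) (D : nat -> set T) (phi : R -> R)
    (f_ : nat -> T -> R) (f : T -> R) :
  0 <= p -> 0 <= M -> (forall x y, `|phi x - phi y| <= M * `|x - y|) ->
  (forall n, measurable (D n)) -> (forall n, measurable_fun setT (f_ n)) ->
  measurable_fun setT f ->
  (\int[mu]_(x in D n) (`|f_ n x - f x| `^ p)%:E @[n --> \oo] --> 0)%E ->
  (\int[mu]_(x in D n) (`|phi (f_ n x) - phi (f x)| `^ p)%:E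
     @[n --> \oo] --> 0)%E.
Proof.
move=> p0 M0 phiM mD mf_ mf cf.
apply: (@squeeze_cvge _ _ _ _ (cst 0%E) _
  (fun n => (M `^ p)%:E * \int[mu]_(x in D n) (`|f_ n x - f x| `^ p)%:E)%E).
- apply: nearW => n; apply/andP; split; last exact: integral_lipschitz_le.
  by apply: integral_ge0 => x _; rewrite lee_fin powR_ge0.
- exact: cvg_cst.
- by rewrite -(mule0 (M `^ p)%:E); apply: cvgeZl.
Qed.

(** * Steep pairs of a function that is not Lipschitz *)

(** Cut the segment from x to y into N+1 equal pieces, short enough for the
    hypothesis to apply to each; the increments of phi along them add up to at
    most (N+1) * (M * |x - y| / (N+1)). *)
Lemma local_bound_global (R : realType) (phi : R -> R) (M : R) : 0 <= M ->
  (forall x y, M * `|x - y| <= 1 -> `|phi x - phi y| <= M * `|x - y|) ->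
  forall x y, `|phi x - phi y| <= M * `|x - y|.
Proof.
move=> M0 locM x y.
have [N NM] : exists N : nat, M * `|x - y| <= N.+1%:R.
  exists (Num.truncn (M * `|x - y|)); exact/ltW/truncnS_gt.
have N0 : 0 < N.+1%:R :> R by rewrite ltr0n.
pose z (i : nat) : R := x + i%:R / N.+1%:R * (y - x).
have stepE i : `|z i - z i.+1| = `|x - y| / N.+1%:R.
  rewrite (_ : z i - z i.+1 = (x - y) / N.+1%:R).
    by rewrite normrM normfV (ger0_norm (ltW N0)).
  rewrite /z -[i.+1%:R]natr1; field.
  by rewrite gt_eqF.
have z0 : z 0%N = x by rewrite /z mul0r mul0r addr0.
have zN : z N.+1 = y by rewrite /z divff ?gt_eqF// mul1r addrC subrK.
rewrite -{1}z0 -{1}zN distrC -(telescope_sumr (phi \o z))//.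
apply: (le_trans (ler_norm_sum _ _ _)).
apply: (@le_trans _ _ (\sum_(0 <= i < N.+1) (M * (`|x - y| / N.+1%:R)))).
  apply: ler_sum => i _ /=; rewrite distrC -(stepE i); apply: locM.
  by rewrite stepE mulrA ler_pdivrMr// mul1r.
by rewrite sumr_const_nat subn0 -[leLHS]mulr_natr -mulrA divfK ?gt_eqF.
Qed.

(** The middle bound is what later keeps the masses of the atoms away from 0;
    it is available because a Lipschitz inequality limited to pairs with
    (n+1) |x - y| <= 1 would already make phi Lipschitz. *)
Lemma not_lipschitz_steep (R : realType) (phi : R -> R) : ~ lipschitz phi ->
  forall n : nat, exists z : R * R,
  [/\ 0 < `|z.1 - z.2|, n.+1%:R * `|z.1 - z.2| <= 1 &
      n.+1%:R * `|z.1 - z.2| <= `|phi z.1 - phi z.2|].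
Proof.
move=> Nlip n; apply: contrapT => Nz; apply: Nlip.
apply: (@bound_lipschitz _ _ n.+1%:R); apply: local_bound_global => // x y xy1.
rewrite leNgt; apply/negP => xylt; apply: Nz; exists (x, y); split => //=.
- rewrite normr_gt0 subr_eq0; apply/eqP => xy.
  by move: xylt; rewrite xy !subrr normr0 mulr0 ltxx.
- exact: ltW.
Qed.

(** * Atomic measures on the natural numbers *)

Definition weighted_counting (R : realType) (w : nat -> {nonneg R}) :
    {measure set nat -> \bar R} :=
  mseries (fun k => mscale (w k) (dirac k)) 0.

Lemma weighted_counting1 (R : realType) (w : nat -> {nonneg R}) (n : nat) :
  weighted_counting w [set n] = (w n)%:num%:E.
Proof.
transitivity (\sum_(0 <= k <oo) (w k)%:num%:E * (k \in [set n])%:R%:E)%E.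
  by apply: eq_eseriesr => k _; rewrite -diracE.
rewrite (nneseriesD1 (n := n))//.
rewrite mem_set// mule1 eseries_mkcond eseries0 ?adde0// => k _ _.
by case: ifPn => // kn; rewrite memNset ?mule0//; exact/eqP.
Qed.

Lemma weighted_counting_small (R : realType) (w : nat -> {nonneg R})
    (A : set nat) : (forall n, 1 <= (w n)%:num) ->
  (weighted_counting w A < 1)%E -> A = set0.
Proof.
move=> w1 A1; rewrite -subset0 => n An.
move: A1; rewrite ltNge => /negP; apply.
apply: (@le_trans _ _ (weighted_counting w [set n])).
  by rewrite weighted_counting1 lee_fin.
by apply: le_measure; rewrite ?inE//; move=> _ ->.
Qed.

Lemma integral_weighted_counting1 (R : realType) (w : nat -> {nonneg R})
    (n : nat) (h : nat -> R) : 0 <= h n -> (forall k, k != n -> h k = 0) ->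
  (\int[weighted_counting w]_k (h k)%:E = (h n * (w n)%:num)%:E)%E.
Proof.
move=> hn0 h0.
rewrite (eq_integral (fun k => (h n * \1_[set n] k)%:E)); last first.
  move=> k _; rewrite indicE; have [->|kn] := eqVneq k n.
    by rewrite mem_set ?mulr1.
  by rewrite h0// memNset ?mulr0//; exact/eqP.
rewrite (integralZl_indic measurableT (fun=> [set n]))//; last first.
  by move=> h_lt0; move: hn0; rewrite leNgt h_lt0.
by rewrite integral_indic// setIT weighted_counting1 EFinM.
Qed.

(** * Comparison of the three modes *)

Lemma cvg_Lp_almost (R : realType) (p : R) d (T : measurableType d)
    (mu : {measure set T -> \bar R}) (f_ : nat -> T -> R) (f : T -> R) :
  cvg_Lp p mu f_ f -> cvg_almost_Lp p mu f_ f.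
Proof.
by move=> cf delta d0; exists set0; rewrite measure0 lte_fin setC0; split.
Qed.

Lemma cvg_Lp_alpha (R : realType) (p : R) d (T : measurableType d)
    (mu : {measure set T -> \bar R}) (f_ : nat -> T -> R) (f : T -> R) :
  cvg_Lp p mu f_ f -> cvg_alpha_p p mu f_ f.
Proof.
move=> cf; exists (fun=> setT); rewrite setCT measure0.
by split => //; exact: cvg_cst.
Qed.

(** The exceptional set for delta = 1 is already empty. *)
Lemma cvg_almost_Lp_atomic (R : realType) (p : R) d (T : measurableType d)
    (mu : {measure set T -> \bar R}) (f_ : nat -> T -> R) (f : T -> R) :
  (forall A, measurable A -> (mu A < 1)%E -> A = set0) ->
  cvg_almost_Lp p mu f_ f -> cvg_Lp p mu f_ f.
Proof.
move=> mu1 /(_ 1 ltr01)[E [mE E1]].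
by rewrite (mu1 E)// setC0.
Qed.

(** As the complements of the B_n have measure tending to 0, they are eventually
    empty, and then the integral over B_n is the integral over the whole
    space. *)
Lemma cvg_alpha_p_atomic (R : realType) (p : R) d (T : measurableType d)
    (mu : {measure set T -> \bar R}) (f_ : nat -> T -> R) (f : T -> R) :
  (forall A, measurable A -> (mu A < 1)%E -> A = set0) ->
  cvg_alpha_p p mu f_ f -> cvg_Lp p mu f_ f.
Proof.
move=> mu1 [B [mB B0]]; apply: cvg_trans; apply: near_eq_cvg.
have B1 : \forall n \near \oo, (mu (~` B n) < 1)%E.
  move/fine_cvgP : B0 => [Bfin /cvgr_lt/(_ _ ltr01) Blt].
  near=> n; rewrite -(@fineK _ (mu (~` B n))); last by near: n.
  by rewrite lte_fin; near: n.
near=> n; suff -> : B n = setT by [].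
rewrite -[B n]setCK (mu1 (~` B n)) ?setC0//; first exact: measurableC.
by near: n.
Unshelve. all: by end_near. Qed.

(** * Characterization of the preserving functions *)

(** The hypotheses on m say that it is weaker than L_p-convergence in general and
    as strong on spaces without small nonempty sets: the first lets the
    counterexample enter, the second brings its image back to L_p. *)
Lemma preserves_lipschitz (R : realType) (p : R) (m : convergence_mode R)
    (phi : R -> R) : 1 <= p ->
  (forall d (T : measurableType d) (mu : {measure set T -> \bar R}) f_ f,
    cvg_Lp p mu f_ f -> m d T mu f_ f) ->
  (forall d (T : measurableType d) (mu : {measure set T -> \bar R}) f_ f,
    (forall A, measurable A -> (mu A < 1)%E -> A = set0) ->
    m d T mu f_ f -> cvg_Lp p mu f_ f) ->
  preserves_convergence m phi -> lipschitz phi.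
Proof.
move=> p1 Lpm mLp pres; apply: contrapT => /not_lipschitz_steep/choice[z zP].
have p0 : 0 < p by exact: lt_le_trans p1.
have one : 1 = 1 `^ p :> R by rewrite powR1.
pose a n := `|(z n).1 - (z n).2|.
have a0 n : 0 < n.+1%:R * a n by rewrite mulr_gt0//; case: (zP n).
(* With this mass, an atom where two functions differ by b contributes
   (b / ((n+1) a_n))^p: this is (n+1)^-p for b = a_n, and at least 1 for
   b >= (n+1) a_n. *)
pose w n : {nonneg R} := NngNum (powR_ge0 (n.+1%:R * a n)^-1 p).
have w1 n : 1 <= (w n)%:num.
  rewrite /= [leLHS]one; apply: ge0_ler_powR; rewrite ?nnegrE ?invr_ge0//.
  - exact: ltW.
  - exact: ltW.
  - by rewrite invf_ge1//; case: (zP n).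
pose mu := weighted_counting w.
pose f (k : nat) := (z k).2.
pose f_ n (k : nat) := if k == n then (z k).1 else f k.
(* Stated for psi to serve both psi = id and psi = phi. *)
have intE (psi : R -> R) n :
    (\int[mu]_k (`|psi (f_ n k) - psi (f k)| `^ p)%:E =
     ((`|psi (z n).1 - psi (z n).2| / (n.+1%:R * a n)) `^ p)%:E)%E.
  rewrite (@integral_weighted_counting1 _ w n (fun k =>
    `|psi (f_ n k) - psi (f k)| `^ p)) ?powR_ge0//; last first.
    by move=> k /negbTE kn; rewrite /f_ kn subrr normr0 powR0 ?gt_eqF.
  by rewrite /f_ eqxx /= -powRM ?invr_ge0 ?(ltW (a0 _)).
have cf : cvg_Lp p mu f_ f.
  rewrite /cvg_Lp.
  apply: (@squeeze_cvge _ _ _ _ (cst 0%E) _ (fun n => (harmonic n : R)%:E)).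
  - apply: nearW => n; rewrite (intE id) !lee_fin powR_ge0/=.
    rewrite -/(a n) invfM mulrCA divff ?mulr1; last first.
      by apply: lt0r_neq0; case: (zP n).
    by apply: ge1r_powR => //; rewrite invr_gt0 ltr0n/= invf_le1 ?ler1n.
  - exact: cvg_cst.
  - by apply: cvg_EFin; [exact: nearW|exact: cvg_harmonic].
have [//|//|_ _ /mLp] := pres _ _ mu f_ f _ _ (Lpm _ _ _ _ _ cf).
move=> /(_ (fun A _ => @weighted_counting_small _ w A w1)).
move=> /fine_cvgP[_ /cvgr_lt/(_ _ ltr01)[N _ /(_ N (leqnn N))]] /=.
rewrite intE /= ltNge => /negP; apply.
rewrite [leLHS]one; apply: ge0_ler_powR; rewrite ?nnegrE ?divr_ge0//.
- exact: ltW.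
- exact: ltW.
- by rewrite ler_pdivlMr// mul1r; case: (zP N).
Qed.

Theorem theorem5p2 (R : realType) (p : R) (hp : 1 <= p) (phi : R -> R) :
  [/\ preserves_convergence (@cvg_Lp R p) phi <-> lipschitz phi,
      preserves_convergence (@cvg_almost_Lp R p) phi <-> lipschitz phi &
      preserves_convergence (@cvg_alpha_p R p) phi <-> lipschitz phi].
Proof.
have p0 : 0 <= p by exact: le_trans hp.
have meas M : 0 <= M -> (forall x y, `|phi x - phi y| <= M * `|x - y|) ->
    forall d (T : measurableType d) (g : T -> R),
    measurable_fun setT g -> measurable_fun setT (phi \o g).
  move=> M0 phiM d T g mg; apply: measurableT_comp mg.
  exact: lipschitz_measurable M0 phiM.
split; split.
- by apply: (preserves_lipschitz hp) => // d T mu f_ f.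
- move=> /lipschitz_bound[M M0 phiM] d T mu f_ f mf_ mf cf.
  split; [by move=> n; exact: meas phiM _ _ _ _|exact: meas phiM _ _ _ _|].
  exact: (@cvg_integral_lipschitz _ p M _ _ mu (fun=> setT)).
- apply: (preserves_lipschitz hp) => d T mu f_ f.
  + exact: cvg_Lp_almost.
  + exact: cvg_almost_Lp_atomic.
- move=> /lipschitz_bound[M M0 phiM] d T mu f_ f mf_ mf cf.
  split; [by move=> n; exact: meas phiM _ _ _ _|exact: meas phiM _ _ _ _|].
  move=> delta /cf[E [mE Ed cE]]; exists E; split => //.
  apply: (@cvg_integral_lipschitz _ p M _ _ mu (fun=> ~` E)) => // n.
  exact: measurableC.
- apply: (preserves_lipschitz hp) => d T mu f_ f.
  + exact: cvg_Lp_alpha.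
  + exact: cvg_alpha_p_atomic.
- move=> /lipschitz_bound[M M0 phiM] d T mu f_ f mf_ mf [B [mB B0 cB]].
  split; [by move=> n; exact: meas phiM _ _ _ _|exact: meas phiM _ _ _ _|].
  by exists B; split => //; exact: (@cvg_integral_lipschitz _ p M).
Qed.
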